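(* Let $K$ be a convex body in $\mathbb{E}^d$, $d \geq 3$, let $k$ be an integer with $2 \leq k \leq d-1$, and let $\{H_{\alpha}\}_{\alpha \in \mathcal{A}}$ be a family of $k$-dimensional affine subspaces of $\mathbb{E}^d$, each of which intersects the interior of $K$, such that: (i) for every supporting line $l$ of $K$ there exists $\alpha \in \mathcal{A}$ with $l \subset H_{\alpha}$; (ii) for every $\alpha \in \mathcal{A}$, the intersection $K \cap H_{\alpha}$ is a $k$-dimensional polytope. Then $K$ is a polytope.
   Context: A convex body is a compact convex subset of $\mathbb{E}^d$ with non-empty interior. A line $l$ is a supporting line of $K$ if $l \cap K \neq \emptyset$ and $l \cap K \subset \partial K$. A (convex) polytope is the convex hull of finitely many points. *)

(* Defs.v *)
(* Points of E^d are row vectors 'rV[R]_d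
   over R : realType, with the canonical (max-norm, hence Euclidean-equivalent)
   topology on matrices provided by MathComp-Analysis. *)
From HB Require Import structures.
From mathcomp Require Import all_boot all_order all_algebra.
From mathcomp Require Import all_classical all_reals all_analysis.
Set Implicit Arguments. Unset Strict Implicit. Unset Printing Implicit Defensive.
Import Order.TTheory GRing.Theory Num.Theory.
Import numFieldNormedType.Exports.
Local Open Scope classical_set_scope.
Local Open Scope ring_scope.

Section Geometry.
Variables (R : realType) (d : nat).
Notation pt := 'rV[R]_d.

Definition convex_set (K : set pt) : Prop :=
  forall x y t, K x -> K y -> 0 <= t -> t <= 1 -> K ((1 - t) *: x + t *: y).

Definition convex_body (K : set pt) : Prop :=
  [/\ compact K, convex_set K & (interior K !=set0)].

Definition bdry (K : set pt) : set pt := closure K `\` interior K.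

Definition affine_subspace (k : nat) (H : set pt) : Prop :=
  exists (p : pt) (B : 'M[R]_(k, d)),
    row_free B /\ H = [set p + u *m B | u in [set: 'rV[R]_k]].

Definition line (l : set pt) : Prop := affine_subspace 1 l.

Definition supporting_line (K : set pt) (l : set pt) : Prop :=
  line l /\ (l `&` K !=set0) /\ (l `&` K `<=` bdry K).

Definition conv_hull (s : seq pt) : set pt :=
  [set x | exists w : 'I_(size s) -> R,
     [/\ forall i, 0 <= w i, \sum_(i < size s) w i = 1 &
         x = \sum_(i < size s) w i *: s`_i]].

Definition polytope (P : set pt) : Prop := exists s : seq pt, P = conv_hull s.

Definition affdim_eq (k : nat) (P : set pt) : Prop :=
  (exists H, affine_subspace k H /\ P `<=` H) /\
  exists (x0 : pt) (X : 'M[R]_(k, d)),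
    [/\ P x0, forall i, P (x0 + row i X) & row_free X].

Definition k_polytope (k : nat) (P : set pt) : Prop := polytope P /\ affdim_eq k P.

End Geometry.

(* Main.v *)
(* Let C_x be the cone generated by K - x. If v is a limit of C_x outside C_x, the
   line x + Rv supports K, hence lies in some H_a; the section of K by H_a being
   a polytope, its cone at x is finitely generated, hence closed, and it contains
   v + e (p - x) for all e > 0, where p in H_a is interior to K. So v is in C_x
   after all: every C_x is closed. This forces K to coincide with x + C_x near each
   of its points x, so the extreme points of K are isolated, and finitely many by
   compactness; Minkowski's theorem concludes. *)
Require Import Defs.
From HB Require Import structures.
From mathcomp Require Import all_boot all_order all_algebra.
From mathcomp Require Import all_classical all_reals all_analysis.
From mathcomp Require Import ring lra.
Set Implicit Arguments. Unset Strict Implicit. Unset Printing Implicit Defensive.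
Import Order.TTheory GRing.Theory Num.Theory.
Import numFieldNormedType.Exports.
Local Open Scope classical_set_scope.
Local Open Scope ring_scope.

(** * Bounds for the max-norm *)

Section Norm.
Variables (R : realType) (d : nat).
Implicit Types v : 'rV[R]_d.

Lemma rV_coord_le_norm v i : `|v 0 i| <= `|v|.
Proof. by rewrite [leRHS]/Num.norm /= mx_normrE; apply/bigmax_geP; right; exists (0, i). Qed.

Lemma rV_norm_le v e : 0 <= e -> (forall i, `|v 0 i| <= e) -> `|v| <= e.
Proof.
move=> e0 ve; rewrite [leLHS]/Num.norm /= mx_normrE.
by apply/bigmax_leP; split=> // -[i j] _ /=; rewrite ord1.
Qed.

End Norm.

Lemma mulmx_bounded (R : realType) (d n : nat) (M : 'M[R]_(d, n)) :
  exists2 c, 0 < c & forall v : 'rV[R]_d, `|v *m M| <= c * `|v|.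
Proof.
pose s := \sum_i \sum_j `|M i j|.
have s0 : 0 <= s by apply: sumr_ge0 => i _; apply: sumr_ge0.
exists (s + 1) => [|v]; first by rewrite ltr_wpDl.
apply: (@le_trans _ _ (s * `|v|)); last by rewrite ler_wpM2r ?lerDl.
apply: rV_norm_le => [|j]; first by rewrite mulr_ge0.
rewrite mxE mulr_suml; apply: (le_trans (ler_norm_sum _ _ _)).
apply: ler_sum => i _; rewrite normrM mulrC.
apply: ler_pM => //; last exact: rV_coord_le_norm.
by rewrite (bigD1 j)//= lerDl sumr_ge0.
Qed.

(** * Finitely generated cones are finite intersections of half-spaces *)

Section Weyl.
Variables (R : realType) (d : nat).
Implicit Types (x g : 'rV[R]_d) (c : 'cV[R]_d).

Definition dot x c : R := (x *m c) 0 0.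

Lemma dotDl x y c : dot (x + y) c = dot x c + dot y c.
Proof. by rewrite /dot mulmxDl mxE. Qed.

Lemma dotBl x y c : dot (x - y) c = dot x c - dot y c.
Proof. by rewrite /dot mulmxBl !mxE. Qed.

Lemma dotZl a x c : dot (a *: x) c = a * dot x c.
Proof. by rewrite /dot -scalemxAl mxE. Qed.

Lemma dotBr x c c' : dot x (c - c') = dot x c - dot x c'.
Proof. by rewrite /dot mulmxBr !mxE. Qed.

Lemma dotZr a x c : dot x (a *: c) = a * dot x c.
Proof. by rewrite /dot -scalemxAr mxE. Qed.

(** The recursion isolates the coefficient of one generator at a time, which is the shape that
    elimination needs. *)
Fixpoint gen_cone (s : seq 'rV[R]_d) (x : 'rV[R]_d) : Prop :=
  if s is g :: s' then exists2 t, 0 <= t & gen_cone s' (x - t *: g)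
  else x = 0.

Lemma seq_between (L U : seq R) :
  (forall u, u \in U -> 0 <= u) ->
  (forall l u, l \in L -> u \in U -> l <= u) ->
  exists t, [/\ 0 <= t, forall l, l \in L -> l <= t & forall u, u \in U -> t <= u].
Proof.
move=> U0 LU; exists (\big[Num.max/0]_(l <- L) l); split.
- exact: bigmax_ge_id.
- by move=> l lL; exact: le_bigmax_seq.
- by move=> u uU; rewrite big_seq; apply: bigmax_le => [|l lL]; [exact: U0|exact: LU].
Qed.

(* Fourier-Motzkin elimination of the coefficient of the head generator. *)
Lemma gen_cone_halfspaces (s : seq 'rV[R]_d) :
  exists F : seq 'cV[R]_d,
    forall x, gen_cone s x <-> (forall c, c \in F -> 0 <= dot x c).
Proof.
elim: s => [|g s [F FP]].
  exists ([seq delta_mx i 0 | i <- enum 'I_d] ++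
          [seq (-1) *: delta_mx i 0 | i <- enum 'I_d]) => x.
  have xE i : dot x (delta_mx i 0) = x 0 i by rewrite /dot -colE mxE.
  split=> [-> c _|x0]; first by rewrite /dot mul0mx mxE.
  apply/rowP => i; rewrite !mxE; apply/eqP; rewrite eq_le; apply/andP; split.
    have := x0 ((-1) *: delta_mx i 0); rewrite dotZr xE mulN1r oppr_ge0; apply.
    rewrite mem_cat; apply/orP; right.
    by apply/mapP; exists i => //; rewrite mem_enum.
  have := x0 (delta_mx i 0); rewrite xE; apply; rewrite mem_cat; apply/orP; left.
  by apply/mapP; exists i => //; rewrite mem_enum.
(* Keep the functionals that are nonnegative at [g]; pair each one positive at [g] with each one
   negative at [g], in the positive combination that vanishes at [g]. *)
exists ([seq c <- F | 0 <= dot g c] ++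
  [seq dot g c *: c' - dot g c' *: c | c <- [seq c <- F | 0 < dot g c],
                                     c' <- [seq c <- F | dot g c < 0]]) => x.
split=> /= [[t t0 /FP xF] c|x0].
  rewrite mem_cat => /orP[|/allpairsP[[a b]]].
    rewrite mem_filter => /andP[gc /xF]; rewrite dotBl dotZl; nra.
  rewrite !mem_filter /= => -[/andP[ga /xF aF] /andP[gb /xF bF] ->].
  by move: aF bF; rewrite dotBr !dotZr !dotBl !dotZl; nra.
have Fnn c : c \in F -> 0 <= dot g c -> 0 <= dot x c.
  by move=> cF gc; apply: x0; rewrite mem_cat mem_filter cF gc.
(* The condition [t * dot g c <= dot x c] bounds [t] from below when [dot g c < 0] and from above
   when [dot g c > 0]. *)
have [u||t [t0 tL tU]] := @seq_between
   [seq dot x c / dot g c | c <- F & dot g c < 0]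
   [seq dot x c / dot g c | c <- F & 0 < dot g c].
- move=> /mapP[c]; rewrite mem_filter => /andP[gc cF] ->.
  by rewrite divr_ge0 ?Fnn// ltW.
- move=> _ _ /mapP[b bF ->] /mapP[a aF ->]; move: aF bF; rewrite !mem_filter.
  move=> /andP[ga aF] /andP[gb bF].
  have : 0 <= dot x (dot g a *: b - dot g b *: a).
    apply: x0; rewrite mem_cat; apply/orP; right.
    by apply/allpairsP; exists (a, b); rewrite !mem_filter /= ga gb aF bF.
  rewrite dotBr !dotZr => h.
  by rewrite ler_ndivrMr// mulrAC ler_pdivrMr//; lra.
exists t => //; apply/FP => c cF; rewrite dotBl dotZl subr_ge0.
have [gc|gc|gc] := ltgtP (dot g c) 0.
- rewrite -ler_ndivrMr//; apply: tL; apply/mapP; exists c => //.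
  by rewrite mem_filter gc.
- rewrite -ler_pdivlMr//; apply: tU; apply/mapP; exists c => //.
  by rewrite mem_filter gc.
- by rewrite gc mulr0 Fnn// gc.
Qed.

(* A finitely generated cone is closed along segments. *)
Lemma gen_cone_segment (s : seq 'rV[R]_d) v q :
  (forall e, 0 < e -> exists2 t, 0 < t & gen_cone s (t *: (v + e *: q))) ->
  gen_cone s v.
Proof.
have [F FP] := gen_cone_halfspaces s.
move=> vq; apply/FP => c cF; rewrite leNgt; apply/negP => vc.
(* Small enough that [e * dot q c] is at most half of [- dot v c], so that [dot (v + e *: q) c]
   stays negative; the [+ 1] avoids a zero denominator. *)
pose e := - dot v c / (2 * (`|dot q c| + 1)).
have q1 : 0 < `|dot q c| + 1 by rewrite ltr_wpDl.
have e0 : 0 < e by rewrite divr_gt0 ?oppr_gt0// mulr_gt0.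
have [t t0 /FP/(_ _ cF)] := vq e e0.
rewrite dotZl pmulr_rge0// dotDl dotZl => h.
have eq : e * dot q c <= - dot v c / 2.
  rewrite /e -[leRHS]mulr1 invfM mulrA -mulrA ler_pM2l ?divr_gt0 ?oppr_gt0//.
  rewrite mulrC ler_pdivrMr// mul1r (le_trans (ler_norm _))// lerDl//.
lra.
Qed.

End Weyl.

(** * The cone generated by [K - x] *)

Section TangentCone.
Variables (R : realType) (d : nat) (K : set 'rV[R]_d).
Hypothesis cK : Defs.convex_set K.
Implicit Types (x y v u p : 'rV[R]_d) (a e t r : R).

Lemma convex_sum n (w : 'I_n -> R) (y : 'I_n -> 'rV[R]_d) :
  (forall i, 0 <= w i) -> (forall i, K (y i)) -> \sum_i w i = 1 ->
  K (\sum_i w i *: y i).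
Proof.
elim: n w y => [|n IH] w y w0 Ky; first by rewrite big_ord0 => /eqP; rewrite eq_sym oner_eq0.
rewrite !big_ord_recl => w1.
set q := \sum_(i < n) w (lift ord0 i) in w1.
have q0 : 0 <= q by apply: sumr_ge0.
have [q0'|qN0] := eqVneq q 0.
  rewrite big1 => [|i _]; first by move: w1; rewrite q0' addr0 => ->; rewrite scale1r addr0.
  move: q0'; rewrite /q => /psumr_eq0P => /(_ (fun i _ => w0 _))/(_ i isT) ->.
  by rewrite scale0r.
have -> : \sum_(i < n) w (lift ord0 i) *: y (lift ord0 i) =
    q *: \sum_(i < n) (w (lift ord0 i) / q) *: y (lift ord0 i).
  by rewrite scaler_sumr; apply: eq_bigr => i _; rewrite scalerA mulrC divfK.
have -> : w ord0 = 1 - q by lra.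
apply: cK => //; last by have := w0 ord0; lra.
by apply: IH => // [i|]; [rewrite divr_ge0|rewrite -mulr_suml divff].
Qed.

Lemma conv_hull_sub s : (forall y, y \in s -> K y) -> conv_hull s `<=` K.
Proof.
by move=> sK _ [w [w0 w1 ->]]; apply: convex_sum => // i; apply/sK/mem_nth.
Qed.

(** For [x] in [K] this is the radial cone, whose closure is the usual tangent cone of a convex set;
    it need not be closed itself. *)
Definition tcone x : set 'rV[R]_d := [set v | exists2 e, 0 < e & K (x + e *: v)].

Lemma convex_ray x v e t : K x -> K (x + e *: v) -> 0 <= t -> t <= e -> K (x + t *: v).
Proof.
move=> Kx Ke t0 te; have [e0|e0] := leP e 0.
  have -> : t = 0 by lra.
  by rewrite scale0r addr0.
have -> : x + t *: v = (1 - t / e) *: x + (t / e) *: (x + e *: v).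
  by apply/rowP => i; rewrite !mxE; field; rewrite gt_eqF.
by apply: cK => //; [rewrite divr_ge0// ltW | rewrite ler_pdivrMr// mul1r].
Qed.

Lemma convex_sym x v a : K (x + v) -> K (x - v) -> `|a| <= 1 -> K (x + a *: v).
Proof.
rewrite ler_norml => Kp Km /andP[a0 a1].
have -> : x + a *: v = (1 - (1 + a) / 2) *: (x - v) + ((1 + a) / 2) *: (x + v).
  by apply/rowP => i; rewrite !mxE; field.
by apply: cK => //; lra.
Qed.

Lemma tconeZ x v a : K x -> 0 <= a -> tcone x v -> tcone x (a *: v).
Proof.
move=> Kx a0 [e e0 Ke]; have [->|aN0] := eqVneq a 0.
  by exists 1; rewrite // scale0r scaler0 addr0.
have ap : 0 < a by rewrite lt0r aN0.
by exists (e / a); [rewrite divr_gt0|rewrite scalerA divfK].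
Qed.

Lemma tcone_sub x y : K y -> tcone x (y - x).
Proof. by move=> Ky; exists 1; rewrite // scale1r addrC subrK. Qed.

Lemma tconeD x v u : K x -> tcone x v -> tcone x u -> tcone x (v + u).
Proof.
move=> Kx [e e0 Ke] [f f0 Kf].
pose g := Num.min e f; have g0 : 0 < g by rewrite lt_min e0 f0.
have Kv : K (x + g *: v) by apply: convex_ray Ke _ _ => //; [exact: ltW|rewrite ge_min lexx].
have Ku : K (x + g *: u) by apply: convex_ray Kf _ _ => //; [exact: ltW|rewrite ge_min lexx orbT].
exists (g / 2); first by rewrite divr_gt0.
have -> : x + (g / 2) *: (v + u) = (1 - 1 / 2) *: (x + g *: v) + (1 / 2) *: (x + g *: u).
  by apply/rowP => i; rewrite !mxE; field.
by apply: cK => //; lra.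
Qed.

Lemma gen_cone_tcone x s v : K x -> (forall y, y \in s -> K y) ->
  gen_cone [seq y - x | y <- s] v -> tcone x v.
Proof.
move=> Kx; elim: s v => [|y s IH] v sK /=.
  by move=> ->; exists 1; rewrite // scaler0 addr0.
move=> [t t0 /IH h]; rewrite -[v](subrK (t *: (y - x))).
apply: tconeD => //; first by apply: h => z zs; apply: sK; rewrite inE zs orbT.
by apply/tconeZ => //; apply/tcone_sub/sK; rewrite inE eqxx.
Qed.

Lemma closure_ball (A : set 'rV[R]_d) v e : closure A v -> 0 < e ->
  exists2 v', A v' & `|v - v'| < e.
Proof.
move=> /(_ _ (nbhsx_ballx v e _)) h e0; have [v' [Av']] := h e0.
by rewrite -ball_normE; exists v'.
Qed.

Lemma interior_ball (A : set 'rV[R]_d) x : interior A x ->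
  exists2 r, 0 < r & forall z, `|z| < r -> A (x + z).
Proof.
move=> /nbhs_normP[r /= r0 rA]; exists r => // z zr; apply: rA => /=.
by rewrite opprD addrA subrr sub0r normrN.
Qed.

(** Take [v'] in the cone close to [v]. A segment from a point [x + e *: v'] of [K] to a suitable
    point near [x - s *: v] crosses the ray from [x] along [v] beyond [x]. Hence a limit direction
    missing from the cone spans a line that avoids the interior of [K] behind [x]. *)
Lemma closure_tcone_backward x s v : 0 <= s -> interior K (x - s *: v) ->
  closure (tcone x) v -> tcone x v.
Proof.
move=> s0 /interior_ball[r r0 rK] /closure_ball.
have s1 : 0 < 2 * (s + 1) by rewrite mulr_gt0// ltr_wpDl.
move=> /(_ (r / (2 * (s + 1))) (divr_gt0 r0 s1)) [v' [e e0 Ke] vv'].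
have v1 : 0 < 2 * (`|v| + 1) by rewrite mulr_gt0// ltr_wpDl.
(* Half of the radius [r] pays for this push along [v], the other half for replacing [v] by [v']. *)
pose z := (r / (2 * (`|v| + 1))) *: v.
have zr : `|z| < r / 2.
  rewrite normrZ ger0_norm ?divr_ge0 ?(ltW r0) ?(ltW v1)//.
  rewrite mulrAC ltr_pdivrMr// [ltRHS]mulrA divfK// ltr_pM2l//; lra.
have /rK : `|s *: (v - v') + z| < r.
  apply: le_lt_trans (ler_normD _ _) _; rewrite normrZ ger0_norm//.
  suff : s * `|v - v'| <= r / 2 by lra.
  apply: (@le_trans _ _ ((s + 1) * (r / (2 * (s + 1))))).
    by rewrite ler_pM// ?lerDl// ltW.
  by rewrite le_eqVlt; apply/orP; left; apply/eqP; field; rewrite gt_eqF// ltr_wpDl.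
move=> Kz; exists (e / (s + e) * (r / (2 * (`|v| + 1)))).
  by rewrite mulr_gt0 ?divr_gt0// ltr_wpDl.
have se : 0 < s + e by rewrite ltr_wpDl.
(* The second endpoint equals [x - s *: v' + z], so the weights cancel [v'] and leave a positive
   multiple of [z]. *)
have -> : x + (e / (s + e) * (r / (2 * (`|v| + 1)))) *: v =
  (1 - e / (s + e)) *: (x + e *: v') + (e / (s + e)) *: (x - s *: v + (s *: (v - v') + z)).
  rewrite -scalerA -/z; apply/rowP => i; rewrite !mxE; field.
  by rewrite ?gt_eqF//; rewrite ltr_wpDl.
apply: cK => //; first by rewrite divr_ge0// ltW.
by rewrite ler_pdivrMr// mul1r; lra.
Qed.

Lemma conv_hull_mem s y : y \in s -> conv_hull s y.
Proof.
move=> ys; have ys' : (index y s < size s)%N by rewrite index_mem.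
exists (fun i => (i == Ordinal ys')%:R); split=> [i||]; first by rewrite ler0n.
- by rewrite (bigD1 (Ordinal ys'))//= eqxx big1 ?addr0// => i /negbTE ->.
- rewrite (bigD1 (Ordinal ys'))//= eqxx scale1r nth_index// big1 ?addr0//.
  by move=> i /negbTE ->; rewrite scale0r.
Qed.

Lemma conv_hull_gen_cone s x y : conv_hull s y -> gen_cone [seq z - x | z <- s] (y - x).
Proof.
move=> [w [w0 w1 ->]]; rewrite -[x in _ - x]scale1r -w1 scaler_suml -sumrB.
(* From here only the signs of the weights matter; their sum would not survive the induction. *)
under eq_bigr do rewrite -scalerBr; clear w1.
elim: s w w0 => [|z s IH] w w0 /=; first by rewrite big_ord0.
exists (w ord0) => //; rewrite big_ord_recl /= addrC addKr.
exact: (IH (fun i => w (lift ord0 i))).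
Qed.

(* Moving v towards the interior point p puts it in the cone of the section. *)
Lemma closure_tcone_section x v p s : K x -> interior K p ->
  conv_hull s `<=` K ->
  (forall a b, K (x + a *: v + b *: (p - x)) -> conv_hull s (x + a *: v + b *: (p - x))) ->
  closure (tcone x) v -> tcone x v.
Proof.
move=> Kx /interior_ball[r r0 rK] sK sH clv.
apply: (@gen_cone_tcone x s) => //; first by move=> y /conv_hull_mem/sK.
apply: (@gen_cone_segment _ _ _ v (p - x)) => e e0.
have [v' v'T vv'] := closure_ball clv (mulr_gt0 e0 r0).
have [t t0 Kt] : tcone x (v + e *: (p - x)).
  (* The error [v - v'], of norm below [e * r], is charged to [p]: shifted by [e^-1 *: (v - v')], it
     stays in the ball of radius [r] inside [K]. *)
  have -> : v + e *: (p - x) = v' + e *: (p + e^-1 *: (v - v') - x).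
    by apply/rowP => i; rewrite !mxE; field; rewrite gt_eqF.
  apply: tconeD => //; apply: tconeZ => //; first exact: ltW.
  apply/tcone_sub/rK; rewrite normrZ gtr0_norm ?invr_gt0//.
  by rewrite mulrC ltr_pdivrMr// mulrC.
exists t => //; rewrite -[X in gen_cone _ X](addKr x) addrC.
apply/conv_hull_gen_cone.
by move: Kt; rewrite scalerDr scalerA addrA; exact: sH.
Qed.

End TangentCone.

(** * Closed tangent cones make a convex set locally conic *)

Section LocallyConic.
Variables (R : realType) (d : nat) (K : set 'rV[R]_d).
Hypothesis cK : Defs.convex_set K.
Implicit Types (x y v u p : 'rV[R]_d) (a e t r : R).

(* The rows of X span a space of directions along which K extends both ways. *)
Definition two_sided x m (X : 'M[R]_(m, d)) : Prop :=
  forall i, K (x + row i X) /\ K (x - row i X).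

(** The two scalars match the matrix built in [two_sided_extend]. *)
Lemma row_free_col m (X : 'M[R]_(m, d)) u a b : row_free X -> ~~ (u <= X)%MS ->
  a != 0 -> b != 0 -> row_free (col_mx (a *: u) (b *: X)).
Proof.
move=> Xf uX a0 b0; apply: inj_row_free => w.
rewrite -[w]hsubmxK mul_row_col; set c := lsubmx w; set f := rsubmx w => cf.
have cu : c *m (a *: u) = (c 0 0 * a) *: u.
  by rewrite [c]mx11_scalar mul_scalar_mx !mxE eqxx mulr1n scalerA.
have c0 : c = 0.
  apply/eqP; apply: contraNT uX => cN0.
  have c00 : c 0 0 != 0.
    by apply: contraNneq cN0 => c00; rewrite [c]mx11_scalar c00 raddf0.
  have : (c 0 0 * a) *: u = (- b *: f) *m X.
    apply/eqP; rewrite -subr_eq0 -cu -scalemxAl scaleNr opprK scalemxAr.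
    by rewrite cf.
  move=> /(congr1 (fun z => (c 0 0 * a)^-1 *: z)).
  rewrite scalerA mulVf ?mulf_neq0// scale1r => ->.
  by rewrite scalemxAl submxMl.
rewrite c0 mul0mx add0r -scalemxAr scalemxAl in cf.
have : b *: f = 0 by apply: (row_free_inj Xf); rewrite cf mul0mx.
move=> /eqP; rewrite scaler_eq0 (negbTE b0) /= => /eqP f0.
by rewrite c0 f0 row_mx0.
Qed.

(** With [w] the coordinates of [l] in the rows of [X], the point [x + l] is the average of the
    points obtained by moving [x] along a single row, by its coordinate times the number of rows;
    for small [l] these factors are at most 1 in absolute value. *)
Lemma two_sided_near x m (X : 'M[R]_(m, d)) : K x -> two_sided x X ->
  exists2 r, 0 < r & forall l : 'rV[R]_d, (l <= X)%MS -> `|l| < r -> K (x + l).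
Proof.
move=> Kx xX; have [c c0 cP] := mulmx_bounded (pinvmx X).
have mc : 0 < m.+1%:R * c by rewrite mulr_gt0.
(* The successor keeps the radius positive when [X] has no rows. *)
exists (m.+1%:R * c)^-1 => [|l lX lr]; first by rewrite invr_gt0.
case: m X xX cP mc lX lr => [|m] X xX cP mc lX lr.
  by move: lX; rewrite (flatmx0 X) => /submx0null ->; rewrite addr0.
pose w := l *m pinvmx X.
have -> : x + l = \sum_(i < m.+1) m.+1%:R^-1 *: (x + (m.+1%:R * w 0 i) *: row i X).
  under eq_bigr do rewrite scalerDr scalerA mulKf ?pnatr_eq0//.
  rewrite big_split /= sumr_const card_ord -scaler_nat scalerA mulfV ?pnatr_eq0//.
  by rewrite scale1r -mulmx_sum_row mulmxKpV.
apply: (convex_sum cK) => [i|i|]; first by rewrite invr_ge0.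
- apply: (convex_sym cK); [exact: (xX i).1|exact: (xX i).2|].
  rewrite normrM ger0_norm//.
  have := rV_coord_le_norm w i; have := cP l; rewrite -/w.
  have : m.+2%:R * c * `|l| < 1 by rewrite mulrC -ltr_pdivlMr// div1r.
  have : m.+1%:R * `|w 0 i| <= m.+2%:R * `|w 0 i| by rewrite ler_wpM2r// ler_nat.
  have : (0 : R) < m.+2%:R by [].
  nra.
- by rewrite sumr_const card_ord -[LHS]mulr_natr mulVf ?pnatr_eq0.
Qed.

(** The homothety of ratio [1 - f / e] centred at [x + e *: u] maps [K] into itself and [x] to
    [x + f *: u], which scales the old directions; the new one [g *: u] works because [f - g] and
    [f + g] lie between [0] and [e]. *)
Lemma two_sided_extend x e f g u m (X : 'M[R]_(m, d)) : K x -> 0 < g ->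
  g <= f -> f + g <= e -> K (x + e *: u) -> two_sided x X ->
  two_sided (x + f *: u) (col_mx (g *: u) ((1 - f / e) *: X)).
Proof.
move=> Kx g0 gf fge Ke xX i; have e0 : 0 < e by lra.
rewrite -[i]splitK; case: (fintype.split i) => j /=.
  rewrite rowKu row_id -addrA -scalerDl -addrA -scalerBl.
  by split; apply: (convex_ray cK) Ke _ _ => //; lra.
have E s : x + f *: u + s *: row j ((1 - f / e) *: X) =
   (1 - f / e) *: (x + s *: row j X) + (f / e) *: (x + e *: u).
  by apply/rowP => k; rewrite !mxE; field; rewrite gt_eqF.
have fe0 : 0 <= f / e by rewrite divr_ge0//; lra.
have fe1 : f / e <= 1 by rewrite ler_pdivrMr//; lra.
have [Kp Km] := xX j; rewrite rowKd; split.
  by rewrite -[row j _]scale1r E; apply: cK => //; rewrite scale1r.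
by rewrite -scaleN1r E; apply: cK => //; rewrite scaleN1r.
Qed.

Definition locally_conic x : Prop :=
  exists2 r, 0 < r & forall v, `|v| < r -> tcone K x v -> K (x + v).

Hypothesis tK : forall x, K x -> closed (tcone K x).

(* A direction u outside span X is nonzero in the tangent cone at
   y = x + (e/2) u in both senses, so K is already conic near y, and the rays
   from x close to u have length at least e/2. *)
Lemma tcone_length_near x e u :
  K x -> 0 < e -> K (x + e *: u) -> locally_conic (x + (e / 2) *: u) ->
  exists2 r, 0 < r & forall v, `|u - v| < r -> tcone K x v -> K (x + (e / 2) *: v).
Proof.
move=> Kx e0 Ke [r r0 rP]; exists (r / e); first by rewrite divr_gt0.
move=> v uv [f f0 Kf].
have -> : x + (e / 2) *: v = x + (e / 2) *: u + (e / 2) *: (v - u).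
  by apply/rowP => i; rewrite !mxE; ring.
apply: rP.
  rewrite normrZ distrC ger0_norm; last by rewrite divr_ge0 ?ltW.
  move: uv; rewrite ltr_pdivlMr// => uv; have := normr_ge0 (u - v); nra.
(* Chosen so that [t * e <= f]: the ray along [v] is known to stay in [K] only up to [f]. *)
pose t := f / (e + f).
have ef : 0 < e + f by rewrite addr_gt0.
have t0 : 0 < t by rewrite divr_gt0.
have t1 : t <= 1 by rewrite ler_pdivrMr// mul1r lerDr ltW.
exists t => //.
have -> : x + (e / 2) *: u + t *: ((e / 2) *: (v - u)) =
  (1 - 1 / 2) *: (x + ((1 - t) * e) *: u) + (1 / 2) *: (x + (t * e) *: v).
  by apply/rowP => i; rewrite !mxE; field.
apply: cK; [ | |lra|lra].
  by apply: (convex_ray cK) Ke _ _ => //; nra.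
apply: (convex_ray cK) Kf _ _ => //; first by rewrite mulr_ge0// ltW.
by rewrite /t mulrAC ler_pdivrMr//; nra.
Qed.

Lemma sphere_compact : compact [set v : 'rV[R]_d | `|v| = 1].
Proof.
apply: bounded_closed_compact.
  exists 1; split; first exact: num_real.
  by move=> M M1 v /= ->; exact: ltW.
rewrite (_ : [set v | _] = (fun v : 'rV[R]_d => `|v|) @^-1` [set 1]); last by apply/seteqP; split.
apply: preimage_closed; last exact: closed_eq.
by move=> v _; exact: norm_continuous.
Qed.

(** Induction on the codimension of the span of [X]. If the span is everything, [x] is interior.
    Otherwise moving from [x] along a direction of the cone outside the span gains a two-sided
    direction, and compactness of the sphere makes the resulting ray lengths uniform. *)
Lemma locally_conic_two_sided n m (X : 'M[R]_(m, d)) x : (d <= n + m)%N ->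
  row_free X -> K x -> two_sided x X -> locally_conic x.
Proof.
elim: n m X x => [|n IH] m X x dm Xf Kx xX; have [r1 r10 r1P] := two_sided_near Kx xX.
  exists r1 => // v vr _; apply: r1P => //; apply: submx_full.
  by rewrite /row_full eqn_leq rank_leq_col (eqP Xf).
pose P e v := tcone K x v -> (v <= X^C)%MS -> K (x + e *: v).
have : \forall e \near 0^'+, [set v : 'rV[R]_d | `|v| = 1] `<=` P e.
  have /compact_near_coveringP := sphere_compact; apply=> u /= u1.
  suff [r [e [r0 e0 reP]]] : exists r e, [/\ 0 < r, 0 < e &
      forall v, `|u - v| < r -> forall t, 0 < t -> t <= e -> P t v].
    exists (ball u r, [set t | 0 < t <= e]) => /=.
      split; first exact: nbhsx_ballx.
      by near=> t; apply/andP; split; near: t; [exact: nbhs_right_gt|exact: nbhs_right_le].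
    by move=> [v t] /= [uv /andP[t0 te]]; apply: reP => //; move: uv; rewrite -ball_normE.
  (* Here closedness of the cone enters: near a [u] outside it, [P] holds vacuously. *)
  have [uT|uT] := pselect (tcone K x u); last first.
    have /nbhs_normP[r /= r0 rP] : nbhs u (~` tcone K x).
      by apply: open_nbhs_nbhs; split=> //; exact/closed_openC/tK.
    by exists r, 1; split=> // v /rP vT t _ _ /vT.
  (* The complement is the kernel of [cokermx], hence also closed: near a [u] outside it, [P] is
     again vacuous. *)
  have [uC|uC] := boolP (u <= X^C)%MS; last first.
    have [c c0 cP] := mulmx_bounded (cokermx (X^C)%MS).
    move: uC; rewrite submxE => uC.
    exists (`|u *m cokermx (X^C)%MS| / c), 1; split=> //.
      by rewrite divr_gt0// normr_gt0.
    move=> v uv t _ _ _; rewrite submxE => /eqP vC; exfalso.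
    have := cP (u - v); rewrite mulmxBl vC subr0.
    by move: uv; rewrite ltr_pdivlMr//; lra.
  have uX : ~~ (u <= X)%MS.
    apply/negP => uX; have := sub_capmx u X (X^C)%MS.
    rewrite uX uC capmx_compl submx0 => /eqP u0.
    by move: u1; rewrite u0 normr0 => /eqP; rewrite eq_sym oner_eq0.
  have [e e0 Ke] := uT.
  have Ky : K (x + (e / 2) *: u) by apply: (convex_ray cK) Ke _ _ => //; lra.
  have [|r r0 rP] := @tcone_length_near x e u Kx e0 Ke.
    apply: (IH (1 + m)%N (col_mx ((e / 2) *: u) ((1 - e / 2 / e) *: X))) => //.
    - by rewrite add1n addnS -addSn.
    - apply: row_free_col => //; rewrite gt_eqF ?divr_gt0//.
      by rewrite subr_gt0 ltr_pdivrMr//; lra.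
    - by apply: two_sided_extend => //; lra.
  exists r, (e / 2); split=> //; first by rewrite divr_gt0.
  move=> v uv t t0 te vT _.
  by apply: (convex_ray cK) (rP _ uv vT) _ _ => //; exact: ltW.
move=> /(filterI (nbhs_right_gt 0)) /filter_ex[e /= [e0 eP]].
(* Split [v] into [w] in the complement and [v - w] in the span of [X]; [x + v] is the midpoint of
   [x + 2 *: (v - w)] and [x + 2 *: w]. *)
pose Q := proj_mx (X^C)%MS <<X>>%MS.
have [c c0 cP] := mulmx_bounded Q.
have C0 : 0 < 2 * (1 + c) by rewrite mulr_gt0 ?addr_gt0.
(* The first bound puts [2 *: (v - w)] within [r1], the second makes [2 *: w] shorter than the
   uniform length [e]. *)
exists (Num.min (r1 / (2 * (1 + c))) (e / (2 * c))).
  by rewrite lt_min !divr_gt0// mulr_gt0.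
move=> v; rewrite lt_min !ltr_pdivlMr// ?mulr_gt0// => /andP[vr ve] vT.
pose w := v *m Q.
have wC : (w <= X^C)%MS by exact: proj_mx_sub.
have lX : (v - w <= X)%MS.
  rewrite -(genmxE X) /w; apply: proj_mx_compl_sub.
  apply: (submx_trans (submx_full v (addsmx_compl_full X))).
  by rewrite addsmxC addsmxS// genmxE.
have wv : `|w| <= c * `|v| by exact: cP.
have lv : `|v - w| <= `|v| + `|w| by exact: ler_normB.
have Kl : K (x + 2 *: (v - w)).
  apply: r1P; first by rewrite scalemx_sub.
  by rewrite normrZ ger0_norm//; nra.
have Nl : tcone K x (w - v).
  exists 2 => //; apply: r1P; first by rewrite scalemx_sub// -opprB eqmx_opp.
  by rewrite normrZ distrC ger0_norm//; nra.
have wT : tcone K x w by rewrite -(subrK v w); exact: tconeD.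
have Kw : K (x + 2 *: w).
  have [->|wN0] := eqVneq w 0; first by rewrite scaler0 addr0.
  have w0 : 0 < `|w| by rewrite normr_gt0.
  have : K (x + e *: (`|w|^-1 *: w)).
    apply: eP => //=.
    - by rewrite normrZ normfV normr_id mulVf ?normr_eq0.
    - by apply: tconeZ => //; rewrite invr_ge0.
    - by rewrite scalemx_sub.
  have -> : 2 *: w = (2 * `|w|) *: (`|w|^-1 *: w).
    by rewrite scalerA mulfK// normr_eq0.
  by move=> Ke; apply: (convex_ray cK) Ke _ _ => //; nra.
have -> : x + v = (1 - 1 / 2) *: (x + 2 *: (v - w)) + (1 / 2) *: (x + 2 *: w).
  by apply/rowP => i; rewrite !mxE; field.
by apply: cK => //; lra.
Unshelve. all: by end_near. Qed.

Lemma convex_locally_conic x : K x -> locally_conic x.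
Proof.
move=> Kx; apply: (@locally_conic_two_sided d 0%N (0 : 'M[R]_(0, d))) => //.
- by rewrite addn0.
- by rewrite /row_free mxrank0.
- by case.
Qed.

End LocallyConic.

(** * Extreme points and Minkowski's theorem *)

Section Extreme.
Variables (R : realType) (d : nat) (K : set 'rV[R]_d).
Hypotheses (cK : Defs.convex_set K) (kK : compact K).
Implicit Types (x y z v u : 'rV[R]_d) (a e t r : R).

(** For convex [K] these are the usual extreme points; the midpoint form makes a nonzero [u] that
    violates it a two-sided direction. *)
Definition extreme : set 'rV[R]_d :=
  [set z | K z /\ forall u, K (z + u) -> K (z - u) -> u = 0].

(** Close to [x], the segment from [x] to [z] can be doubled within [K], which makes [z] a
    midpoint. *)
Lemma locally_conic_extreme x : K x -> locally_conic K x ->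
  nbhs x [set z | extreme z -> z = x].
Proof.
move=> Kx [r r0 rP]; apply/nbhs_ballP; exists (r / 2) => /=; first by rewrite divr_gt0.
rewrite -ball_normE => z /= xz [Kz zE]; apply/eqP; rewrite -subr_eq0; apply/eqP/zE.
  rewrite (_ : z + _ = x + 2 *: (z - x)); last by apply/rowP => i; rewrite !mxE; ring.
  apply: rP; first by rewrite normrZ ger0_norm// distrC; lra.
  by apply: tconeZ => //; exact: tcone_sub.
by rewrite opprB addrC subrK.
Qed.

(** Cover [K] by open sets containing no extreme point other than their centre; the centres of a
    finite subcover form the list. *)
Lemma finite_extreme : (forall x, K x -> locally_conic K x) ->
  exists s : seq 'rV[R]_d, (forall y, y \in s -> K y) /\
    (forall z, extreme z -> z \in s).
Proof.
move=> lK; pose U x := interior [set z | extreme z -> z = x].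
move: kK; rewrite compact_cover => /(_ _ K U) [x Kx|x Kx|D DK KD].
- exact: open_interior.
- by exists x => //; apply: nbhs_singleton; apply/nbhs_interior/locally_conic_extreme => //; exact: lK.
exists (finmap.enum_fset D); split=> [y yD|z ze]; first by have /DK := yD; rewrite inE.
have [x xD /interior_subset/= ->//] := KD z ze.1.
Qed.

(** The supremum of the admissible parameters is finite since [K] is bounded and attained since [K]
    is closed. *)
Lemma compact_exit z u : K z -> u != 0 ->
  exists t, [/\ 0 <= t, K (z + t *: u) & forall t', t < t' -> ~ K (z + t' *: u)].
Proof.
move=> Kz u0; pose E := [set t | 0 <= t /\ K (z + t *: u)].
have un : 0 < `|u| by rewrite normr_gt0.
have E0 : E 0 by split=> //; rewrite scale0r addr0.
have [M [Mr MP]] := compact_bounded kK.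
have supE : has_sup E.
  split; first by exists 0.
  exists ((M + 1 + `|z|) / `|u|) => t [t0 Kt]; rewrite ler_pdivlMr//.
  have /MP/(_ _ Kt)/= : M < M + 1 by rewrite ltrDl.
  have := ler_normB (z + t *: u) z.
  rewrite addrAC subrr add0r normrZ ger0_norm//; lra.
have ubE := ub_le_sup supE.2.
exists (sup E); split; first exact: ubE.
  have clK : closed K by apply: compact_closed => //; exact: norm_hausdorff.
  apply: contrapT => NK.
  have /nbhs_normP[r /= r0 rP] : nbhs (z + sup E *: u) (~` K).
    by apply: open_nbhs_nbhs; split=> //; exact: closed_openC.
  have [t [t0 Kt] tE] := sup_adherent (divr_gt0 r0 un) supE.
  apply: (rP (z + t *: u)) => //=.
  rewrite opprD addrACA subrr add0r -scalerBl normrZ -ltr_pdivlMr//.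
  have : t <= sup E by exact: ubE.
  by move=> tS; rewrite ger0_norm; lra.
move=> t' tt' Kt'; have : t' <= sup E; last by rewrite leNgt tt'.
by apply: (ubE); split=> //; apply: le_trans (ltW tt'); exact: ubE.
Qed.

Lemma conv_hull_convex s : Defs.convex_set (conv_hull s : set 'rV[R]_d).
Proof.
move=> _ _ t [w [w0 w1 ->]] [f [f0 f1 ->]] t0 t1.
exists (fun i => (1 - t) * w i + t * f i); split=> [i||].
- by rewrite addr_ge0// mulr_ge0// subr_ge0.
- by rewrite big_split /= -!mulr_sumr w1 f1; ring.
- rewrite !scaler_sumr -big_split /=; apply: eq_bigr => i _.
  by rewrite !scalerA -scalerDl.
Qed.

(* Every point that is not extreme lies between two exit points of a segment,
   at which K has strictly fewer independent two-sided directions. *)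
Lemma minkowski (s : seq 'rV[R]_d) : (forall z, extreme z -> z \in s) ->
  K `<=` conv_hull s.
Proof.
move=> sE z Kz.
suff H n : forall z, K z -> (forall m (X : 'M[R]_(m, d)), row_free X ->
    two_sided K z X -> (m <= n)%N) -> conv_hull s z.
  by apply: (H d) => // m X /eqP Xm _; rewrite -Xm; exact: rank_leq_col.
elim: n => [|n IH] {Kz}z Kz zn.
  apply/conv_hull_mem/sE; split=> // u Kp Km; apply/eqP; apply/negPn/negP => u0.
  suff : (1 <= 0)%N by [].
  apply: (zn 1%N u) => [|i]; last by rewrite row_id.
  by rewrite /row_free rank_rV u0.
have [/sE/conv_hull_mem //|zE] := pselect (extreme z).
have exit u : u != 0 -> K (z + u) -> K (z - u) ->
    exists2 t, 0 <= t & conv_hull s (z + t *: u).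
  move=> u0 Kp Km; have [t [t0 Kt tmax]] := compact_exit Kz u0.
  exists t => //; apply: IH => // m X Xf aX.
  have t1 : 1 <= t.
    by rewrite leNgt; apply/negP => /tmax; rewrite scale1r.
  (* If [u] were in the span of [X], [K] would continue along [u] past the exit point. *)
  have uX : ~~ (u <= X)%MS.
    apply/negP => uX; have [r r0 rP] := two_sided_near cK Kt aX.
    have un : 0 < `|u| by rewrite normr_gt0.
    pose e := r / (2 * `|u|).
    have e0 : 0 < e by rewrite divr_gt0// mulr_gt0.
    apply: (tmax (t + e)); first by rewrite ltrDl.
    rewrite scalerDl addrA; apply: rP; first by rewrite scalemx_sub.
    rewrite normrZ gtr0_norm// /e mulrAC ltr_pdivrMr ?mulr_gt0//.
    by rewrite ltr_pM2l//; lra.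
  have zE' : z = z + t *: u + t *: - u by rewrite scalerN addrK.
  rewrite -ltnS -add1n.
  (* Going back from the exit point towards [z - u], at distance [t + 1] in units of [u], reaches
     [z] at [t]; the step [1] on both sides fits because [1 <= t]. So [z] has one direction more
     than the exit point. *)
  apply: (zn _ (col_mx (1 *: - u) ((1 - t / (t + 1)) *: X))).
    apply: row_free_col => //; rewrite ?eqmx_opp//.
    by rewrite gt_eqF// subr_gt0 ltr_pdivrMr; lra.
  rewrite zE'; apply: two_sided_extend => //.
  by rewrite scalerN scalerDl scale1r opprD addrA addrK.
have [u [u0 Kp Km]] : exists u, [/\ u != 0, K (z + u) & K (z - u)].
  apply: contrapT => nu; apply: zE; split=> // u Kp Km.
  by apply/eqP/negPn/negP => u0; apply: nu; exists u.
have [t t0 zt] := exit u u0 Kp Km.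
have [|||r r0 zr] := exit (- u); rewrite ?oppr_eq0 ?opprK//.
have [t0'|tN0] := eqVneq t 0; first by move: zt; rewrite t0' scale0r addr0.
have tr : 0 < t + r by rewrite ltr_wpDr// lt0r tN0.
have -> : z = (1 - t / (t + r)) *: (z + t *: u) + (t / (t + r)) *: (z + r *: - u).
  by apply/rowP => i; rewrite !mxE; field; rewrite gt_eqF.
apply: conv_hull_convex => //; first by rewrite divr_ge0// ltW.
by rewrite ler_pdivrMr// mul1r lerDl.
Qed.

Lemma closed_tcone_polytope : (forall x, K x -> closed (tcone K x)) -> polytope K.
Proof.
move=> tK; have [s [sK sE]] := finite_extreme (convex_locally_conic cK tK).
by exists s; apply/seteqP; split; [exact: minkowski|exact: conv_hull_sub].
Qed.

End Extreme.

(** * From supporting lines to closed tangent cones *)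

Lemma affine_subspace_comb (R : realType) (d k : nat) (H : set 'rV[R]_d) x y z a b :
  affine_subspace k H -> H x -> H y -> H z ->
  H (x + a *: (y - x) + b *: (z - x)).
Proof.
move=> [q [B [_ ->]]] [u _ <-] [v _ <-] [w _ <-].
exists (u + a *: (v - u) + b *: (w - u)) => //.
rewrite !mulmxDl -!scalemxAl !mulmxBl.
by apply/rowP => i; rewrite !mxE; ring.
Qed.

Unset Implicit Arguments.

Theorem theorem1 (R : realType) (d k : nat) (A : Type)
    (H : A -> set 'rV[R]_d) (K : set 'rV[R]_d) :
  (3 <= d)%N -> (2 <= k)%N -> (k <= d - 1)%N ->
  convex_body K ->
  (forall a, affine_subspace k (H a)) ->
  (forall a, H a `&` interior K !=set0) ->
  (forall l, supporting_line K l -> exists a, l `<=` H a) ->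
  (forall a, k_polytope k (K `&` H a)) ->
  polytope K.
Proof.
move=> _ _ _ [kK cK _] Haff Hint Hline Hpoly.
apply: closed_tcone_polytope => // x Kx v vT; apply: contrapT => vNT.
pose l := [set x + u *m v | u in [set: 'rV[R]_1]].
have lE y : l y -> exists t, y = x + t *: v.
  by move=> [u _ <-]; exists (u 0 0); rewrite [u]mx11_scalar mul_scalar_mx !mxE mulr1n.
have El t : l (x + t *: v) by exists t%:M => //; rewrite mul_scalar_mx.
have [a la] : exists a, l `<=` H a.
  apply: Hline; split; [|split].
  - exists x, v; split=> //; rewrite /row_free rank_rV.
    have [v0|//] := eqVneq v 0; exfalso; apply: vNT; rewrite v0.
    by exists 1; rewrite // scaler0 addr0.
  - by exists x; split=> //; have := El 0; rewrite scale0r addr0.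
  - move=> y [/lE[t ->] Ky]; split; first exact: subset_closure.
    (* An interior point of [K] on the line would put [v] in the cone: directly if it lies ahead of
       [x], through [closure_tcone_backward] otherwise. *)
    move=> yint; apply: vNT; have [t0|t0] := ltP 0 t.
      by exists t.
    apply: (closure_tcone_backward cK (s := - t)) vT; first by rewrite oppr_ge0.
    by rewrite scaleNr opprK.
have [p [Hp Kp]] := Hint a; have [[s sE] _] := Hpoly a.
have Hx : H a x by apply: la; have := El 0; rewrite scale0r addr0.
have Hv : H a (x + v) by apply: la; have := El 1; rewrite scale1r.
apply: vNT; apply: (closure_tcone_section cK (p := p) (s := s)) vT => //.
  by rewrite -sE => y [].
move=> b c Kbc; rewrite -sE; split=> //.
(* [H a] contains [x], [x + v] and [p], hence all their affine combinations. *)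
have := affine_subspace_comb b c (Haff a) Hx Hv Hp.
by rewrite [x + v]addrC addrK.
Qed.
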